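(* Define integers $a_{j,k}$ for $j,k\ge 0$ by $a_{j,0}=1$ for all $j\ge 0$, $a_{0,k}=a_{1,k}=0$ for all $k>0$, and $$a_{j,k}=a_{j-1,k}-a_{j-2,k-1}\qquad (j>1,\ k>0).$$ Then the numbers $a_{j,k}$ are the coefficients of the $j$-th Dyck polynomial: for all integers $0\le j\le i$ with $i+j$ even, setting $n=(i+j)/2$, $$d_{i,j}=\sum_{k=0}^{\lfloor j/2\rfloor} a_{j,k}\,c_{n-k}.$$
   Context: Here $c_m=\frac{(2m)!}{m!(m+1)!}$ is the $m$-th Catalan number ($c_0=1$). The label $d_{i,j}$ of an integer point $(i,j)$ with $i,j\ge 0$ is the number of lattice paths from $(0,0)$ to $(i,j)$ composed of up-steps $(1,1)$ and down-steps $(1,-1)$ that never go below the $x$-axis. The $j$-th Dyck polynomial is the expression $p_j(n)$ of $d_{i,j}$, $n=(i+j)/2$, as a linear combination of $c_n,c_{n-1},c_{n-2},\dots$ with coefficients depending only on $j$; the array $(a_{j,k})$ is the polynomial matrix. *)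

(* Defs.v *)
From mathcomp Require Import all_boot all_order all_algebra.

Set Implicit Arguments.
Unset Strict Implicit.
Unset Printing Implicit Defensive.

Import Order.TTheory GRing.Theory Num.Theory.
Local Open Scope ring_scope.

(* The division is exact, see [catalan_dvd]. *)
Definition catalan (m : nat) : nat := ((2 * m)`! %/ (m`! * m.+1`!))%N.

Lemma catalan_dvd (m : nat) : (m`! * m.+1`! %| (2 * m)`!)%N.
Proof.
have mE : (2 * m - m = m)%N by rewrite mul2n -addnn addnK.
have dC : (m.+1 %| 'C(2 * m, m))%N.
  rewrite -(@Gauss_dvdr _ m) ?coprimeSn //.
  have := mul_bin_left (2 * m) m.
  by rewrite mE => <-; apply: dvdn_mulr.
have le_m : (m <= 2 * m)%N by rewrite leq_pmull.
rewrite -(bin_fact le_m) mE.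
by rewrite factS mulnCA dvdn_mul.
Qed.

(* A path is the sequence of its steps, [true] standing for (1,1) and [false]
   for (1,-1); [height s] is the ordinate of the endpoint of [s], whose
   abscissa is [size s]. *)
Definition height (s : seq bool) : int :=
  \sum_(up <- s) (if up then 1 else -1).

(* The label d_{i,j}: since every step increases the abscissa by 1, the paths
   from (0,0) to (i,j) are those with i steps and final height j. *)
Definition dyck_label (i j : nat) : nat :=
  #|[set s : i.-tuple bool |
      (height s == j%:Z) && [forall m : 'I_i.+1, 0 <= height (take m s)]]|.

Fixpoint polymx_coef (j k : nat) : int :=
  match j, k with
  | _, 0 => 1
  | j1.+1, k1.+1 =>
      if j1 is j2.+1 then polymx_coef j1 k - polymx_coef j2 k1 else 0
  | 0, _.+1 => 0
  end.

(* Main.v *)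
Require Import Defs.
From mathcomp Require Import all_boot all_order all_algebra.
From mathcomp Require Import zify ring.

Set Implicit Arguments.
Unset Strict Implicit.
Unset Printing Implicit Defensive.

Import Order.TTheory GRing.Theory Num.Theory.
Local Open Scope ring_scope.

(** The last step of a path ending at (i+1, j+1) leaves from (i, j) or from
    (i, j+2), so d_{i,j+2} = d_{i+1,j+1} - d_{i,j} ([dyck_labelSS]).  The point
    (i+1, j+1) has the same half-sum n as (i, j+2), while (i, j) has half-sum
    n - 1: along fixed j the labels, as functions of n, satisfy
    p_{j+2}(n) = p_{j+1}(n) - p_j(n-1).  Comparing the coefficients of c_{n-k},
    this is exactly the recurrence that defines a_{j,k}
    ([dyck_polynomial_rec]).  By induction on j it remains to treat j = 0 and
    j = 1, where d_{i,1} = d_{i+1,0} because the only way to reach the axis is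
    a down-step from height 1.

    That d_{2n,0} is the Catalan number, defined here by its factorial formula,
    comes from the ballot formula
    d_{i,j} = 'C(i, n) - 'C(i, n+1) with n = (i+j)/2 ([dyck_label_ballot]),
    itself an induction on i where Pascal's rule matches the last-step
    recurrence. *)

(** * Labels and their last-step recurrence *)

Definition nonneg_path (s : seq bool) : bool :=
  all (fun m => 0 <= height (take m s)) (iota 0 (size s).+1).

Lemma height_rcons (s : seq bool) (b : bool) :
  height (rcons s b) = height s + (if b then 1 else -1).
Proof. by rewrite /height -cats1 big_cat big_seq1. Qed.

Lemma nonneg_path_rcons (s : seq bool) (b : bool) :
  nonneg_path (rcons s b) = nonneg_path s && (0 <= height (rcons s b)).
Proof.
rewrite /nonneg_path size_rcons -addn1 iotaD all_cat add0n all_seq1.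
rewrite [take (size s).+1 _]take_oversize ?size_rcons //; congr (_ && _).
apply: eq_in_all => m; rewrite mem_iota add0n /= ltnS => le_m.
by rewrite -cats1 takel_cat.
Qed.

Lemma nonneg_path_height (s : seq bool) : nonneg_path s -> 0 <= height s.
Proof.
by move=> /allP/(_ (size s)); rewrite take_size; apply; rewrite mem_iota /=.
Qed.

Lemma dyck_labelE (i j : nat) :
  dyck_label i j =
    #|[set s : i.-tuple bool | (height s == j%:Z) && nonneg_path s]|.
Proof.
congr #|pred_of_set _|; apply/setP => s; rewrite !inE; congr (_ && _).
apply/forallP/allP => [Hs m | Hs m].
  by rewrite mem_iota size_tuple => lt_m; apply: (Hs (Ordinal lt_m)).
by apply: Hs; rewrite mem_iota size_tuple /= add0n.
Qed.

Lemma card_tuple_rcons (T : finType) (i : nat) (P : pred (seq T)) :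
  #|[set s : i.+1.-tuple T | P s]| =
    (\sum_(x : T) #|[set s : i.-tuple T | P (rcons s x)]|)%N.
Proof.
pose f (u : T * i.-tuple T) : i.+1.-tuple T := [tuple of rcons u.2 u.1].
have f_inj : injective f.
  move=> [x s] [y t] /(congr1 val) /= /rcons_inj[/val_inj -> ->] //.
have f_bij : bijective f.
  by apply: inj_card_bij => //; rewrite card_prod !card_tuple expnS.
rewrite -sum1dep_card (reindex f) /=; last exact: onW_bij.
rewrite (eq_bigl (fun u : T * i.-tuple T => true && P (rcons u.2 u.1))) //.
rewrite -(pair_big_dep xpredT (fun x (s : i.-tuple T) => P (rcons s x))
            (fun _ _ => 1%N)) /=.
by apply: eq_bigr => x _; rewrite sum1dep_card.
Qed.

Lemma dyck_label_rcons (i j : nat) :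
  dyck_label i.+1 j =
    (#|[set s : i.-tuple bool | (height s + 1 == j%:Z)%R && nonneg_path s]|
     + dyck_label i j.+1)%N.
Proof.
rewrite !dyck_labelE.
rewrite (card_tuple_rcons _ (fun s => (height s == j%:Z) && nonneg_path s)).
rewrite big_bool /=; congr addn;
  congr #|pred_of_set _|; apply/setP => s; rewrite !inE
    nonneg_path_rcons height_rcons.
all: case: (boolP (nonneg_path s)) => [/nonneg_path_height|]; lia.
Qed.

Lemma dyck_labelS0 (i : nat) : dyck_label i.+1 0 = dyck_label i 1.
Proof.
rewrite dyck_label_rcons (_ : [set s | _] = set0) ?cards0 //.
apply/setP => s; rewrite !inE.
by apply/negP => /andP[/eqP hs /nonneg_path_height]; lia.
Qed.

Lemma dyck_labelSS (i j : nat) :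
  dyck_label i.+1 j.+1 = (dyck_label i j + dyck_label i j.+2)%N.
Proof.
rewrite dyck_label_rcons (dyck_labelE i j); congr addn.
congr #|pred_of_set _|; apply/setP => s; rewrite !inE; congr (_ && _).
by apply/eqP/eqP; lia.
Qed.

Lemma dyck_label0 (j : nat) : dyck_label 0 j = (j == 0%N).
Proof.
rewrite dyck_labelE; case: j => [|j] /=.
  apply/eqP/cards1P; exists [tuple]; apply/setP => s.
  by rewrite !inE tuple0 /nonneg_path /= /height big_nil.
by apply: eq_card0 => s; rewrite !inE tuple0 /height big_nil.
Qed.

(** * The ballot formula and the Catalan numbers *)

(** Induction on i by Pascal's rule, in additive form to stay in [nat].  For
    j > i all three terms vanish, so the point (i, j+2) of the last-step
    recurrence needs no separate treatment near the diagonal. *)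
Lemma dyck_label_ballot (i j n : nat) :
  (i + j = n.*2)%N -> (dyck_label i j + 'C(i, n.+1) = 'C(i, n))%N.
Proof.
elim: i j n => [|i IHi] [|j] n ijE.
- by rewrite dyck_label0 (_ : n = 0%N) //; lia.
- by rewrite dyck_label0 !bin0n; case: n ijE.
- case: n ijE => [|n] ijE; first by lia.
  have iE : i = n.*2.+1 by lia.
  have := IHi 1%N n.+1; rewrite dyck_labelS0 !binS.
  (* The two middle binomials of the odd row i coincide by symmetry. *)
  have symC : 'C(i, n.+1) = 'C(i, n).
    by rewrite -bin_sub; [congr binomial|]; lia.
  lia.
case: n ijE => [|n] ijE; first by lia.
rewrite dyck_labelSS !binS.
have := IHi j n; have := IHi j.+2 n.+1; lia.
Qed.

Lemma catalan_bin (n : nat) : (catalan n * n.+1 = 'C(n.*2, n))%N.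
Proof.
have fact_catalan := divnK (catalan_dvd n); rewrite -/(catalan n) in fact_catalan.
have := @bin_fact n.*2 n; rewrite -addnn leq_addr addnK => /(_ isT).
rewrite addnn -mul2n -fact_catalan factS => binE.
have fact_pos : (0 < n`! * n`!)%N by rewrite muln_gt0 fact_gt0.
apply/eqP; rewrite -(eqn_pmul2r fact_pos) binE; apply/eqP; ring.
Qed.

Lemma dyck_label_axis (n : nat) : dyck_label n.*2 0 = catalan n.
Proof.
have := @dyck_label_ballot n.*2 0 n (addn0 _).
have := mul_bin_left n.*2 n; rewrite -{2}addnn addnK => binS_n.
have := catalan_bin n.
have : (0 < n.+1)%N by [].
nia.
Qed.

(** * The polynomial matrix *)

Lemma polymx_coef0 (j : nat) : polymx_coef j 0 = 1.
Proof. by case: j. Qed.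

Lemma polymx_coefSS (j k : nat) :
  polymx_coef j.+2 k.+1 = polymx_coef j.+1 k.+1 - polymx_coef j k.
Proof. by []. Qed.

Lemma polymx_coef_eq0 (j k : nat) : (j < k.*2)%N -> polymx_coef j k = 0.
Proof.
elim/ltn_ind: j k => -[|[|j]] IHj [|k] //= ltjk.
by rewrite -/(polymx_coef j.+1 k.+1) !IHj ?subr0 //; lia.
Qed.

Definition dyck_polynomial (j n : nat) : int :=
  \sum_(0 <= k < (j %/ 2).+1) polymx_coef j k * (catalan (n - k))%:Z.

(** As the missing coefficients vanish, the sums for different j can all be
    taken over one range. *)
Lemma dyck_polynomial_widen (j n N : nat) : (j %/ 2 <= N)%N ->
  dyck_polynomial j n =
    \sum_(0 <= k < N.+1) polymx_coef j k * (catalan (n - k))%:Z.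
Proof.
move=> le_jN; rewrite (@big_cat_nat _ _ _ (j %/ 2).+1) //=.
rewrite [X in _ = _ + X]big_nat_cond [X in _ = _ + X]big1 ?addr0 // => k ltjk.
by rewrite polymx_coef_eq0 ?mul0r //; lia.
Qed.

Lemma dyck_polynomial_rec (j n : nat) :
  dyck_polynomial j.+2 n.+1 =
    dyck_polynomial j.+1 n.+1 - dyck_polynomial j n.
Proof.
rewrite (@dyck_polynomial_widen j.+1 _ (j %/ 2).+1); last by lia.
rewrite /dyck_polynomial (_ : j.+2 %/ 2 = (j %/ 2).+1)%N; last by lia.
rewrite big_nat_recl // [X in _ = X - _]big_nat_recl // !polymx_coef0 -addrA.
congr (_ + _); rewrite -sumrB; apply: eq_bigr => k _.
by rewrite polymx_coefSS subSS mulrBl.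
Qed.

(** Rewriting d_{i,j+2} as d_{i+1,j+1} - d_{i,j} trades height for length at
    constant half-sum n, so i must be free in the induction on j. *)
Lemma dyck_label_polynomial (i j n : nat) :
  (i + j = n.*2)%N -> (dyck_label i j)%:Z = dyck_polynomial j n.
Proof.
elim/ltn_ind: j i n => -[|[|j]] IHj i n ijE.
- rewrite addn0 in ijE; rewrite ijE dyck_label_axis.
  by rewrite /dyck_polynomial big_nat1 mul1r subn0.
- rewrite -dyck_labelS0 (_ : i.+1 = n.*2) ?dyck_label_axis; last by lia.
  by rewrite /dyck_polynomial big_nat1 mul1r subn0.
case: n ijE => [|n] ijE; first by lia.
rewrite dyck_polynomial_rec -(IHj j.+1 _ i.+1) -?(IHj j _ i); try by lia.
by rewrite dyck_labelSS; lia.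
Qed.

Theorem mainTheorem4 (i j : nat) (le_ji : (j <= i)%N)
    (even_ij : ~~ odd (i + j)) :
  let n := ((i + j) %/ 2)%N in
  (dyck_label i j)%:Z =
    \sum_(0 <= k < (j %/ 2).+1) polymx_coef j k * (catalan (n - k))%:Z.
Proof. by move=> n; apply: dyck_label_polynomial; rewrite /n; lia. Qed.
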